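(* For any instance, any real number $t\ge1$, any $t$-cohesive group $N^*$, and any allocation $R'$ selected by Generalized PAV, the average satisfaction of $N^*$ with respect to $R'$ is strictly greater than $t-1$.
   Context: Model: There is a set of agents $N=\{1,\dots,n\}$. The resource $R$ consists of a cake $C=[0,c]$ for a real $c\ge 0$ and a set of indivisible goods $G=\{g_1,\dots,g_m\}$ for an integer $m\ge 0$, with $\max(c,m)>0$. A piece of cake is a union of finitely many disjoint closed subintervals of $C$; its length $\ell(\cdot)$ is the sum of the lengths of its intervals. A bundle $R'=(C',G')$ consists of a piece of cake $C'\subseteq C$ and a set $G'\subseteq G$; its size is $s(R')=\ell(C')+|G'|$. Each agent $i$ approves a bundle $R_i=(C_i,G_i)$, and her utility for a bundle $R'$ is $u_i(R')=\ell(C_i\cap C')+|G_i\cap G'|$. A parameter $\alpha\in(0,c+m]$ is given; an allocation is a bundle $A$ with $s(A)\le\alpha$. For a real $t>0$, $N^*\subseteq N$ is $t$-cohesive if $|N^*|\ge t n/\alpha$ and $s(\bigcap_{i\in N^*}R_i)\ge t$. Generalized harmonic numbers: $H_x\coloneqq\sum_{k=1}^\infty\frac{x}{k(x+k)}$ for real $x\ge0$. Generalized PAV selects an allocation $R'$ with $s(R')\le\alpha$ maximizing $\sum_{i\in N}H_{u_i(R')}$. The average satisfaction of a group $N'\subseteq N$ with respect to $A$ is $\frac1{|N'|}\sum_{i\in N'}u_i(A)$. *)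

(* Defs.v *)
From HB Require Import structures.
From mathcomp Require Import all_boot all_order all_algebra.
From mathcomp Require Import all_classical all_reals.
From mathcomp Require Import topology normedtype sequences measure lebesgue_measure.
Set Implicit Arguments. Unset Strict Implicit. Unset Printing Implicit Defensive.
Import Order.TTheory GRing.Theory Num.Theory.
Local Open Scope classical_set_scope.
Local Open Scope ring_scope.

Section Model.
Variable R : realType.

Definition interval_union (s : seq (R * R)) : set R :=
  [set x | has (fun I => (I.1 <= x) && (x <= I.2)) s].

Definition is_piece (c : R) (X : set R) : Prop :=
  exists s : seq (R * R),
    [/\ all (fun I => (0 <= I.1) && (I.1 <= I.2) && (I.2 <= c)) s,
        pairwise (fun I J => (I.2 < J.1) || (J.2 < I.1)) s
      & X = interval_union s].

Definition len (X : set R) : R := fine (lebesgue_measure X).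

Definition bsize (m : nat) (X : set R) (G : {set 'I_m}) : R := len X + #|G|%:R.

Definition util (m : nat) (Ci : set R) (Gi : {set 'I_m}) (X : set R) (G : {set 'I_m}) : R :=
  len (Ci `&` X) + #|Gi :&: G|%:R.

Definition is_allocation (m : nat) (c alpha : R) (X : set R) (G : {set 'I_m}) : Prop :=
  is_piece c X /\ bsize X G <= alpha.

Definition genH (x : R) : R :=
  limn (fun N : nat => \sum_(1 <= k < N) (x / (k%:R * (x + k%:R)))).

Definition cohesive (n m : nat) (c alpha : R) (Ci : 'I_n -> set R)
    (Gi : 'I_n -> {set 'I_m}) (t : R) (Ns : {set 'I_n}) : Prop :=
  t * n%:R / alpha <= #|Ns|%:R /\
  t <= bsize (`[0, c] `&` \bigcap_(i in [set i | i \in Ns]) Ci i)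
             (\bigcap_(i in Ns) Gi i).

Definition is_genPAV (n m : nat) (c alpha : R) (Ci : 'I_n -> set R)
    (Gi : 'I_n -> {set 'I_m}) (X : set R) (G : {set 'I_m}) : Prop :=
  is_allocation c alpha X G /\
  forall (X' : set R) (G' : {set 'I_m}), is_allocation c alpha X' G' ->
    \sum_(i < n) genH (util (Ci i) (Gi i) X' G')
      <= \sum_(i < n) genH (util (Ci i) (Gi i) X G).

Definition avg_sat (n m : nat) (Ci : 'I_n -> set R) (Gi : 'I_n -> {set 'I_m})
    (Ns : {set 'I_n}) (X : set R) (G : {set 'I_m}) : R :=
  (\sum_(i in Ns) util (Ci i) (Gi i) X G) / #|Ns|%:R.

End Model.

(* Main.v *)
(** If the average satisfaction of the group were at most t - 1, the commonly
    approved bundle would leave at least one unit outside the selected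
    allocation A, either a whole good or cake of length 1.  Add it, giving A'.
    The total utility rises by at least n/alpha: the members of the group gain
    1/(u_i + 1) each, and u_i + 1 is at most t on average.  Since A is optimal,
    A' exceeds the budget by some e in (0, 1], and restoring the budget, either
    by dropping one good or by dropping cake of length e, loses at least
    n/alpha.  Cake can be dropped so that every agent loses the same fraction
    of her cake utility, because the cake splits into finitely many intervals
    on which all approvals are constant.  An agent with utility v loses at most
    d/v from giving up d <= 1, so averaging over the possible drops bounds the
    size of A' by alpha, a contradiction. *)
Require Import Defs.
From HB Require Import structures.
From mathcomp Require Import all_boot all_order all_algebra.
From mathcomp Require Import all_classical all_reals.
From mathcomp Require Import topology normedtype sequences measure lebesgue_measure.
From mathcomp Require Import ring lra.
Set Implicit Arguments. Unset Strict Implicit. Unset Printing Implicit Defensive.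
Import Order.TTheory GRing.Theory Num.Theory numFieldNormedType.Exports.
Local Open Scope classical_set_scope.
Local Open Scope ring_scope.

(** * Generalized harmonic numbers *)

Section Harmonic.
Context (R : realType).
Implicit Types x y u d : R.

Definition genH_partial (N : nat) x : R := \sum_(1 <= k < N) (x / (k%:R * (x + k%:R))).

Lemma nondecreasing_genH_partial x : 0 <= x ->
  nondecreasing_seq (genH_partial ^~ x).
Proof.
move=> x0; apply/nondecreasing_seqP => -[|N].
  by rewrite /genH_partial !big_geq.
rewrite /genH_partial [leRHS]big_nat_recr//= lerDl divr_ge0//.
by rewrite mulr_ge0 ?addr_ge0.
Qed.

(** As [x + k >= (k + 1) / 2] for [k >= 1], the term of index [k] is at most
    [2 * x * (1/k - 1/(k + 1))], which telescopes. With monotonicity this gives convergence. *)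
Lemma genH_partial_le x N : 0 <= x -> genH_partial N x <= 2 * x.
Proof.
move=> x0; case: N => [|N]; first by rewrite /genH_partial big_geq// mulr_ge0.
suff: genH_partial N.+1 x <= 2 * x * (1 - N.+1%:R^-1).
  move/le_trans; apply; rewrite -[leRHS]mulr1 ler_wpM2l ?mulr_ge0//.
  by rewrite lerBlDr lerDl invr_ge0.
elim: N => [|N IH]; first by rewrite /genH_partial big_geq// invr1 subrr mulr0.
rewrite /genH_partial big_nat_recr//=; apply: le_trans (lerD IH (lexx _)) _.
rewrite -lerBrDl -mulrBr opprD addrACA subrr add0r opprK.
set k : R := N.+1%:R; have k1 : 1 <= k by rewrite ler1n.
rewrite -[N.+2%:R]natr1 -/k.
have -> : 2 * x * (- (k + 1)^-1 + k^-1) = x / (k * ((k + 1) / 2)).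
  by field; rewrite !gt_eqF//; lra.
rewrite ler_wpM2l// lef_pV2 ?posrE ?mulr_gt0//; [|lra..].
by rewrite ler_pM2l; lra.
Qed.

Lemma cvg_genH x : 0 <= x -> genH_partial ^~ x @ \oo --> genH x.
Proof.
move=> x0; apply: nondecreasing_is_cvgn; first exact: nondecreasing_genH_partial.
by exists (2 * x) => _ [N _ <-]; exact: genH_partial_le.
Qed.

(** Each term equals [1/k - 1/(x + k)], which increases with [x]. *)
Lemma genH_le x y : 0 <= x -> x <= y -> genH x <= genH y.
Proof.
move=> x0 xy; have y0 := le_trans x0 xy.
apply: ler_cvg_to (cvg_genH x0) (cvg_genH y0) _.
apply: nearW => N; rewrite /genH_partial big_nat_cond [leRHS]big_nat_cond.
apply: ler_sum => k /andP[/andP[k1 _] _].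
have k0 : 0 < k%:R :> R by rewrite ltr0n.
have -> : x / (k%:R * (x + k%:R)) = k%:R^-1 - (x + k%:R)^-1.
  by field; rewrite !gt_eqF//; lra.
have -> : y / (k%:R * (y + k%:R)) = k%:R^-1 - (y + k%:R)^-1.
  by field; rewrite !gt_eqF//; lra.
by rewrite lerD2l lerN2 lef_pV2 ?posrE; lra.
Qed.

Lemma genH_add1 x : 0 <= x -> (x + 1)^-1 <= genH (x + 1) - genH x.
Proof.
move=> x0; have x1 : 0 <= x + 1 by rewrite addr_ge0.
(* The truncated difference telescopes to [1/(x + 1)] minus an error; [2 * harmonic] dominates that
   error uniformly in [x], and the factor 2 absorbs the index shift. *)
have cl : (fun N => (x + 1)^-1 - 2 * @harmonic R N) @ \oo --> (x + 1)^-1 - 2 * 0.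
  by apply: cvgB; [exact: cvg_cst|apply: cvgMr; exact: cvg_harmonic].
rewrite -[leLHS]subr0 -[in leLHS](mulr0 2).
apply: ler_cvg_to cl (cvgB (cvg_genH x1) (cvg_genH x0)) _.
apply: nearW; case=> [|N]; rewrite !fctE /genH_partial.
  rewrite !big_geq// subrr divr1 subr_le0.
  by apply: (@le_trans _ _ 1); rewrite ?invf_le1 ?lerDr//; lra.
have -> : \sum_(1 <= k < N.+1) ((x + 1) / (k%:R * (x + 1 + k%:R))) -
    \sum_(1 <= k < N.+1) (x / (k%:R * (x + k%:R))) = (x + 1)^-1 - (x + N.+1%:R)^-1.
  elim: N => [|N IH]; first by rewrite !big_geq// !subrr.
  rewrite [X in X - _]big_nat_recr//= [X in _ - X]big_nat_recr//= opprD addrACA IH -[N.+2%:R]natr1.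
  set k : R := N.+1%:R; have k1 : 1 <= k by rewrite ler1n.
  by field; rewrite !gt_eqF//; lra.
rewrite lerD2l lerN2 /harmonic /= -[N.+2%:R]natr1; set k : R := N.+1%:R.
have k1 : 1 <= k by rewrite ler1n.
have -> : 2 * (k + 1)^-1 = ((k + 1) / 2)^-1 by field; rewrite gt_eqF; lra.
by rewrite lef_pV2 ?posrE; lra.
Qed.

(* Termwise, 1/(u-d+k) - 1/(u+k) <= d (1/(u+k-1) - 1/(u+k)) as d <= 1, and the
   bound telescopes to d / u. *)
Lemma genH_sub_le u d : 0 <= d -> d <= 1 -> d <= u ->
  genH u - genH (u - d) <= d / u.
Proof.
move=> d0 d1 du; have u0 := le_trans d0 du.
have [->|un0] := eqVneq d 0; first by rewrite subr0 subrr mul0r.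
have {}un0 : 0 < u by apply: lt_le_trans du; rewrite lt_neqAle eq_sym un0.
have ud0 : 0 <= u - d by rewrite subr_ge0.
apply: ler_cvg_to (cvgB (cvg_genH u0) (cvg_genH ud0)) (cvg_cst (d / u)) _.
apply: nearW; case=> [|N]; rewrite !fctE /genH_partial.
  by rewrite !big_geq// subrr divr_ge0.
suff: \sum_(1 <= k < N.+1) (u / (k%:R * (u + k%:R))) -
    \sum_(1 <= k < N.+1) ((u - d) / (k%:R * (u - d + k%:R))) <= d * (u^-1 - (u + N%:R)^-1).
  move/le_trans; apply; rewrite ler_wpM2l// lerBlDr lerDl invr_ge0.
  by rewrite addr_ge0.
elim: N => [|N IH]; first by rewrite !big_geq// addr0 !subrr mulr0.
rewrite [X in X - _]big_nat_recr//= [X in _ - X]big_nat_recr//= opprD addrACA.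
apply: le_trans (lerD IH (lexx _)) _; rewrite -[N.+1%:R]natr1; set k : R := N%:R; have k0 : 0 <= k by [].
rewrite -lerBrDl -mulrBr.
have -> : u / ((k + 1) * (u + (k + 1))) - (u - d) / ((k + 1) * (u - d + (k + 1))) =
    d * ((u - d + (k + 1)) * (u + k + 1))^-1.
  by field; rewrite !gt_eqF//; lra.
have -> : u^-1 - (u + (k + 1))^-1 - (u^-1 - (u + k)^-1) = ((u + k) * (u + k + 1))^-1.
  by field; rewrite !gt_eqF//; lra.
rewrite ler_wpM2l// lef_pV2 ?posrE ?mulr_gt0//; [|lra..].
by rewrite ler_pM2r; lra.
Qed.
End Harmonic.

(** * Pieces of cake and their lengths *)

Section Pieces.
Context (R : realType).
Implicit Types (c a b p q theta : R) (I J : R * R) (s : seq (R * R)) (A B D X Y Z : set R).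

Let within c I := (0 <= I.1) && (I.1 <= I.2) && (I.2 <= c).
Let apart I J := (I.2 < J.1) || (J.2 < I.1).

Lemma interval_union_cons I s :
  interval_union (I :: s) = `[I.1, I.2] `|` interval_union s.
Proof.
apply/seteqP; split => x; rewrite /interval_union/= in_itv/=.
  by move=> /orP[]; [left|right].
by move=> [->|->]; rewrite ?orbT.
Qed.

Lemma interval_union0 : interval_union [::] = set0 :> set R.
Proof. by apply/seteqP; split => x. Qed.

(** Pieces of cake without the disjointness requirement. The two notions agree, but here a union is
    just a concatenation of lists. *)
Definition closed_union c X : Prop :=
  exists s, all (within c) s /\ X = interval_union s.

(** An interval of [s] that meets [J] is merged with [J] and taken out of [s]; hence the induction
    on the length of the list, for all [J]. *)
Lemma is_piece_insert c J s : within c J -> all (within c) s -> pairwise apart s ->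
  is_piece c (interval_union (J :: s)).
Proof.
elim: (size s) {-2}s (erefl (size s)) J => [|k IH] {}s sk J cJ cs ds.
  by exists [:: J]; split => //=; [rewrite andbT|rewrite (size0nil sk)].
have [Js|] := boolP (all (apart J) s).
  by exists (J :: s); split => //=; rewrite ?Js//; apply/andP.
rewrite -has_predC => /hasP[I Is /= JI].
have ps := perm_to_rem Is.
have := cs; rewrite (perm_all _ ps)/= => /andP[cI crs].
have -> : interval_union (J :: s) =
    interval_union ((Num.min I.1 J.1, Num.max I.2 J.2) :: rem I s).
  apply/seteqP; split => x; rewrite /interval_union/= (perm_has _ ps)/= orbA.
    move=> /orP[h|->]; last by rewrite orbT.
    apply/orP; left; rewrite ge_min le_max.
    by case/orP: h => /andP[-> ->]; rewrite ?orbT.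
  move=> /orP[|->]; last by rewrite orbT.
  rewrite ge_min le_max => h; apply/orP; left; apply/orP.
  move: JI h cI cJ; rewrite /within /apart negb_or -!leNgt.
  case: (leP J.1 x); case: (leP x J.2); case: (leP I.1 x); case: (leP x I.2) => //=;
    rewrite ?orbT ?orbF; try (by [left|right]); lra.
apply: IH => //.
- by rewrite size_rem// sk.
- move: cI cJ; rewrite /within/= le_min ge_max ge_min !le_max.
  by move=> /andP[/andP[-> ->] ->] /andP[/andP[-> ->] ->].
- exact: subseq_pairwise (rem_subseq _ _) ds.
Qed.

Lemma is_piece_closed_union c X : closed_union c X -> is_piece c X.
Proof.
move=> [s [cs ->{X}]]; elim: s cs => [|J s IH] /=; first by exists [::].
move=> /andP[cJ /IH[s' [cs' ds' e]]].
by rewrite interval_union_cons e -interval_union_cons; apply: is_piece_insert.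
Qed.

Lemma closed_union_is_piece c X : is_piece c X -> closed_union c X.
Proof. by move=> [s [? _ ->]]; exists s. Qed.

Lemma closed_unionU c X Y : closed_union c X -> closed_union c Y ->
  closed_union c (X `|` Y).
Proof.
move=> [s [cs ->]] [s' [cs' ->]]; exists (s ++ s'); split; first by rewrite all_cat cs.
by apply/seteqP; split => x; rewrite /interval_union/= has_cat => /orP.
Qed.

Lemma closed_union_itv c a b : 0 <= a -> a <= b -> b <= c -> closed_union c `[a, b].
Proof.
move=> a0 ab bc; exists [:: (a, b)]; split; first by rewrite /= /within /= a0 ab bc.
by rewrite interval_union_cons interval_union0 setU0.
Qed.

Lemma closed_union0 c : closed_union c set0.
Proof. by exists [::]; rewrite interval_union0. Qed.

Lemma closed_unionI c X Y : closed_union c X -> closed_union c Y ->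
  closed_union c (X `&` Y).
Proof.
move=> [s [cs ->]] [s' [cs' ->]].
elim: s cs => [|I s IH] /=; first by rewrite interval_union0 set0I => _; exact: closed_union0.
move=> /andP[cI /IH cIs]; rewrite interval_union_cons setIUl.
apply: closed_unionU => // {IH cIs s}.
elim: s' cs' => [|J s IH] /=; first by rewrite interval_union0 setI0 => _; exact: closed_union0.
move=> /andP[cJ /IH cJs]; rewrite interval_union_cons setIUr.
apply: closed_unionU => // {IH cJs s}.
move: cI cJ; rewrite /within => /andP[/andP[I0 I12] Ic] /andP[/andP[J0 J12] Jc].
have [IJ|IJ] := leP (Num.max I.1 J.1) (Num.min I.2 J.2).
  have -> : `[I.1, I.2] `&` `[J.1, J.2] =
      [set` `[Num.max I.1 J.1, Num.min I.2 J.2]] :> set R.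
    apply/seteqP; split => x /=; rewrite !in_itv/= ge_max le_min.
      by move=> [/andP[-> ->] /andP[-> ->]].
    by move=> /andP[/andP[-> ->] /andP[-> ->]].
  by apply: closed_union_itv => //; rewrite ?le_max ?ge_min ?I0 ?Ic.
rewrite (_ : _ `&` _ = set0); first exact: closed_union0.
rewrite -subset0 => x /=; rewrite !in_itv/= => -[/andP[? ?] /andP[? ?]].
move: IJ; rewrite ltNge => /negP; apply.
by apply: (@le_trans _ _ x); rewrite ?ge_max ?le_min; apply/andP.
Qed.

Lemma closed_union_sub c X : closed_union c X -> X `<=` `[0, c].
Proof.
move=> [s [cs ->]] x /hasP[I Is /andP[Ix xI]] /=.
have /andP[/andP[? ?] ?] := allP cs _ Is.
by rewrite in_itv/=; apply/andP; split; lra.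
Qed.

Lemma measurable_closed_union c X : closed_union c X -> measurable X.
Proof.
move=> [s [_ ->]]; elim: s => [|I s IH]; first by rewrite interval_union0; exact: measurable0.
by rewrite interval_union_cons; apply: measurableU => //; exact: measurable_itv.
Qed.

(** * Lengths of sets, and pieces of cake taken in prescribed proportions *)

Lemma len_itv a b : a <= b -> len `[a, b] = b - a.
Proof.
move=> ab; rewrite /len lebesgue_measure_itv/= lte_fin.
by case: ltgtP ab => // -> _; rewrite subrr.
Qed.

Lemma len_itvoo a b : a <= b -> len `]a, b[ = b - a.
Proof.
move=> ab; rewrite /len lebesgue_measure_itv/= lte_fin.
by case: ltgtP ab => // -> _; rewrite subrr.
Qed.

(** Since [fine] sends an infinite measure to 0, monotonicity and additivity of [len] rest on
    finiteness, which boundedness provides. *)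
Lemma fin_num_lebesgue a b X : measurable X -> X `<=` `[a, b] ->
  lebesgue_measure X \is a fin_num.
Proof.
move=> mX Xab; rewrite ge0_fin_numE//.
apply: (@le_lt_trans _ _ (lebesgue_measure [set` `[a, b]])).
  by apply: le_measure; rewrite ?inE//; exact: measurable_itv.
by rewrite lebesgue_measure_itv/=; case: ifP => _; rewrite ltry.
Qed.

Lemma len_ge0 X : 0 <= len X.
Proof. exact: fine_ge0. Qed.

Lemma le_len a b X Y : measurable X -> measurable Y -> X `<=` Y -> Y `<=` `[a, b] ->
  len X <= len Y.
Proof.
move=> mX mY XY Yab; apply: fine_le.
- by apply: (fin_num_lebesgue (a := a) (b := b)) => //; exact: subset_trans Yab.
- exact: fin_num_lebesgue Yab.
- by apply: le_measure; rewrite ?inE.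
Qed.

Lemma len_eq0 X : lebesgue_measure X = 0%E -> len X = 0.
Proof. by rewrite /len => ->. Qed.

Lemma lebesgue_null_sub_endpoints x y X : measurable X -> X `<=` [set x; y] ->
  lebesgue_measure X = 0%E.
Proof.
move=> mX XS.
have mS : measurable [set x; y] by apply: measurableU; exact: measurable_set1.
have S0 : lebesgue_measure [set x; y] = 0%E :> \bar R.
  exact: (null_set_setU (mu := lebesgue_measure) (measurable_set1 x) (measurable_set1 y)
    (lebesgue_measure_set1 x) (lebesgue_measure_set1 y)).
exact: (subset_measure0 (mu := lebesgue_measure) mX mS XS S0).
Qed.

Lemma lenU_null a b X Y : measurable X -> measurable Y -> X `<=` `[a, b] -> Y `<=` `[a, b] ->
  lebesgue_measure (X `&` Y) = 0%E -> len (X `|` Y) = len X + len Y.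
Proof.
move=> mX mY Xab Yab XY.
have fX := fin_num_lebesgue mX Xab; have fY := fin_num_lebesgue mY Yab.
have UXY : (lebesgue_measure (X `|` Y) = lebesgue_measure X + lebesgue_measure Y)%E.
  transitivity (lebesgue_measure X + lebesgue_measure Y - lebesgue_measure (X `&` Y))%E.
    by apply: (measureUfinr (mu := lebesgue_measure)) => //; rewrite ltey_eq fY.
  by rewrite XY sube0.
by rewrite /len UXY fineD.
Qed.

Lemma lenU a b X Y : measurable X -> measurable Y -> X `<=` `[a, b] -> Y `<=` `[a, b] ->
  X `&` Y = set0 -> len (X `|` Y) = len X + len Y.
Proof.
move=> mX mY Xab Yab XY; apply: lenU_null Xab Yab _; rewrite // XY.
exact: (measure0 lebesgue_measure).
Qed.

(** Only membership of the two endpoints is open, so the length is squeezed between those of the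
    open and the closed interval. *)
Lemma len_setI_cover D x y : measurable D -> x <= y -> `]x, y[ `<=` D ->
  len (D `&` `[x, y]) = y - x.
Proof.
move=> mD xy h; have mxy : measurable (`[x, y] : set R) by exact: measurable_itv.
have mI : measurable (D `&` `[x, y]) by exact: measurableI.
apply/eqP; rewrite eq_le; apply/andP; split.
  by rewrite -len_itv//; apply: (@le_len x y) => //; exact: subIsetr.
rewrite -len_itvoo//; apply: (@le_len x y) => //.
by rewrite subsetI; split => //; exact: subset_itv_oo_cc.
Qed.

Lemma len_setI_disjoint D x y : measurable D -> `]x, y[ `<=` ~` D ->
  len (D `&` `[x, y]) = 0.
Proof.
move=> mD h; apply/len_eq0/(@lebesgue_null_sub_endpoints x y).
  by apply: measurableI => //; exact: measurable_itv.
move=> z [Dz]; rewrite /= in_itv/= => /andP[xz zy].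
have [->|zx] := eqVneq z x; [by left|right]; have [//|zy'] := eqVneq z y.
by case: (h z) => //=; rewrite in_itv/= !lt_neqAle xz zy zy' eq_sym zx.
Qed.

(* D is constant on each open subinterval of [a, b] avoiding the points pts. *)
Definition step_on a b (pts : seq R) D :=
  forall x y, a <= x -> x < y -> y <= b -> (forall p, p \in pts -> p <= x \/ y <= p) ->
    `]x, y[ `<=` D \/ `]x, y[ `<=` ~` D.

(** [Z] is chosen before [D], so one piece serves all approvals at once. Without breakpoints each
    [D] fills or misses the interval up to endpoints, and an initial segment of relative length
    [theta] works; a breakpoint strictly inside splits the interval, and the two pieces are
    united. *)
Lemma step_on_scale c theta pts a b : 0 <= theta -> theta <= 1 ->
  0 <= a -> a <= b -> b <= c ->
  exists Z, [/\ closed_union c Z, Z `<=` `[a, b] &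
    forall D, measurable D -> step_on a b pts D ->
      len (D `&` Z) = theta * len (D `&` `[a, b])].
Proof.
move=> t0 t1; elim: pts a b => [|p pts IH] a b a0 ab bc.
  have tab : 0 <= theta * (b - a) <= b - a.
    by rewrite mulr_ge0 ?subr_ge0//= ler_piMl ?subr_ge0.
  have sub : `[a, a + theta * (b - a)] `<=` (`[a, b] : set R).
    by move=> z; rewrite /= !in_itv/= => /andP[? ?]; apply/andP; split; lra.
  exists [set` `[a, a + theta * (b - a)]]; split => //.
    by apply: closed_union_itv; lra.
  (* For [a = b] the hypothesis [step_on] is void, but both lengths are 0. *)
  move=> D mD Dab; move: ab; rewrite le_eqVlt => /predU1P[ab|ab].
    by subst b; rewrite subrr mulr0 addr0 !len_eq0 ?mulr0//;
      apply: (@lebesgue_null_sub_endpoints a a); rewrite ?set_itv1 ?setUid;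
      [exact: measurableI|exact: subIsetr].
  have subo : `]a, a + theta * (b - a)[ `<=` (`]a, b[ : set R).
    by move=> z; rewrite /= !in_itv/= => /andP[? ?]; apply/andP; split; lra.
  case: (Dab a b) => // h.
    rewrite (len_setI_cover mD (ltW ab) h) len_setI_cover//; try lra.
    exact: subset_trans h.
  by rewrite (len_setI_disjoint mD h) len_setI_disjoint ?mulr0//; exact: subset_trans h.
have [/andP[ap pb]|napb] := boolP ((a < p) && (p < b)).
  have [] // := IH a p; try lra.
  move=> Z1 [cZ1 Z1ap lZ1].
  have [] // := IH p b; try lra.
  move=> Z2 [cZ2 Z2pb lZ2].
  have apb : `[a, p] `<=` (`[a, b] : set R).
    by move=> z; rewrite /= !in_itv/= => /andP[? ?]; apply/andP; split; lra.
  have pbb : `[p, b] `<=` (`[a, b] : set R).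
    by move=> z; rewrite /= !in_itv/= => /andP[? ?]; apply/andP; split; lra.
  have glue D Y1 Y2 : measurable D -> measurable Y1 -> measurable Y2 ->
      Y1 `<=` `[a, p] -> Y2 `<=` `[p, b] ->
      len (D `&` (Y1 `|` Y2)) = len (D `&` Y1) + len (D `&` Y2).
    move=> mD m1 m2 s1 s2; rewrite setIUr; apply: (@lenU_null a b).
    - exact: measurableI.
    - exact: measurableI.
    - by move=> z [_ /s1 /apb].
    - by move=> z [_ /s2 /pbb].
    apply: (@lebesgue_null_sub_endpoints p p).
      by apply: measurableI; exact: measurableI.
    move=> z [[_ /s1 +] [_ /s2]]; rewrite /= !in_itv/= => /andP[? ?] /andP[? ?]; left.
    by apply: le_anti; apply/andP.
  exists (Z1 `|` Z2); split.
  - exact: closed_unionU.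
  - by rewrite subUset; split; [apply: subset_trans apb|apply: subset_trans pbb].
  move=> D mD Dab.
  have -> : [set` `[a, b]] = `[a, p] `|` `[p, b] :> set R.
    apply/seteqP; split => z /=; last by case => [/apb|/pbb].
    rewrite !in_itv/= => /andP[az zb].
    by have [zp|pz] := leP z p; [left; rewrite az|right; rewrite zb andbT; lra].
  have mZ1 := measurable_closed_union cZ1; have mZ2 := measurable_closed_union cZ2.
  rewrite !glue//.
  rewrite mulrDr lZ1// ?lZ2//.
  - move=> x y px xy yb hp; apply: Dab => //; first lra.
    by move=> q; rewrite inE => /predU1P[->|/hp//]; left.
  - move=> x y px xy yb hp; apply: Dab => //; first lra.
    by move=> q; rewrite inE => /predU1P[->|/hp//]; right.
(* A point outside the open interval constrains no subinterval, so it can be discarded. *)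
have [Z [cZ Zab lZ]] := IH a b a0 ab bc.
exists Z; split => // D mD Dab; apply: lZ => // x y ax xy yb hp; apply: Dab => // q.
rewrite inE => /predU1P[->|/hp//].
by move: napb; rewrite negb_and -!leNgt => /orP[?|?]; [left|right]; lra.
Qed.

(** Pieces are unions of closed intervals, hence not stable under set difference; this larger class
    is, and scaling applies to it. *)
Definition step_set c D :=
  [/\ measurable D, D `<=` `[0, c] & exists pts, step_on 0 c pts D].

Lemma step_onW a b pts pts' D : {subset pts <= pts'} ->
  step_on a b pts D -> step_on a b pts' D.
Proof. by move=> ss h x y ax xy yb hp; apply: h => // p /ss; exact: hp. Qed.

Lemma step_setD c D E : step_set c D -> step_set c E -> step_set c (D `\` E).
Proof.
move=> [mD Dc [pD hD]] [mE Ec [pE hE]]; split; first exact: measurableD.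
  by move=> z [/Dc].
exists (pD ++ pE) => x y x0 xy yc hp.
have sD : {subset pD <= pD ++ pE} by move=> p; rewrite mem_cat => ->.
have sE : {subset pE <= pD ++ pE} by move=> p; rewrite mem_cat orbC => ->.
have [Dxy|Dxy] := step_onW sD hD x0 xy yc hp.
- have [Exy|Exy] := step_onW sE hE x0 xy yc hp.
  + by right=> z zxy [_]; apply; exact: Exy.
  + by left=> z zxy; split; [exact: Dxy|exact: Exy].
- by right=> z zxy [+ _]; exact: Dxy.
Qed.

Lemma step_set_closed_union c X : closed_union c X -> step_set c X.
Proof.
move=> cX; split; [exact: measurable_closed_union cX|exact: closed_union_sub|].
case: cX => s [_ ->]; exists (map fst s ++ map snd s) => x y _ xy _.
elim: s => [|I s IH] hp; first by right=> z _; rewrite interval_union0.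
have [p /=|h|h] := IH; last 2 first.
- by left; rewrite interval_union_cons => z /h; right.
- rewrite interval_union_cons; have [yI|Iy] := leP y I.1.
    right=> z zxy [|]; last exact: h.
    by move: zxy; rewrite /= !in_itv/= => /andP[? ?] /andP[? ?]; lra.
  have Ix : I.1 <= x by case: (hp I.1); rewrite ?mem_head// leNgt Iy.
  have [Ix2|xI2] := leP I.2 x.
    right=> z zxy [|]; last exact: h.
    by move: zxy; rewrite /= !in_itv/= => /andP[? ?] /andP[? ?]; lra.
  have yI : y <= I.2.
    by case: (hp I.2); rewrite ?mem_cat ?mem_head ?orbT// leNgt xI2.
  left=> z; rewrite /= !in_itv/= => /andP[? ?]; left; apply/andP; split; lra.
- by move=> pp; apply: hp; rewrite mem_cat !inE; move: pp; rewrite mem_cat => /orP[]->; rewrite ?orbT.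
Qed.

(** Pooling the breakpoints of all the sets makes a single [Z] work for the whole finite family. *)
Lemma step_set_scale c theta (T : finType) (D : T -> set R) :
  0 <= c -> 0 <= theta -> theta <= 1 -> (forall i, step_set c (D i)) ->
  exists2 Z, closed_union c Z & forall i, len (D i `&` Z) = theta * len (D i).
Proof.
move=> c0 t0 t1 sD.
have /fin_all_exists[pts hpts] i : exists pts, step_on 0 c pts (D i) by case: (sD i).
have [Z [cZ _ lZ]] :=
  @step_on_scale c theta (flatten [seq pts i | i : T]) 0 c t0 t1 (lexx _) c0 (lexx _).
exists Z => // i; have [mD Dc _] := sD i.
rewrite lZ//; first by rewrite setIidl.
apply: step_onW (hpts i) => p pi; apply/flattenP; exists (pts i) => //.
by apply: map_f; rewrite mem_enum.
Qed.

End Pieces.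

(** * Removing from and adding to an allocation *)

Section Instance.
Context (R : realType) (n m : nat) (c alpha : R).
Context (Ci : 'I_n -> set R) (Gi : 'I_n -> {set 'I_m}).
Context (c0 : 0 <= c) (pCi : forall i, closed_union c (Ci i)).
Implicit Types (X Y : set R) (G : {set 'I_m}) (Ns : {set 'I_n}).

Local Notation u X G i := (util (Ci i) (Gi i) X G).

Lemma util_ge0 X G i : 0 <= u X G i.
Proof. by rewrite addr_ge0 ?len_ge0. Qed.

Lemma closed_union_bigcap Ns :
  closed_union c (`[0, c] `&` \bigcap_(i in [set i | i \in Ns]) Ci i).
Proof.
have -> : [set` `[0, c]] `&` \bigcap_(i in [set i | i \in Ns]) Ci i =
    `[0, c] `&` \bigcap_(i in [set i | i \in enum Ns]) Ci i :> set R.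
  by congr (_ `&` _); apply: eq_bigcapl; split => i /=; rewrite mem_enum.
(* An empty intersection is the whole line; the factor [[0, c]] keeps the base case a piece of
   cake. *)
elim: (enum Ns) => [|i s IH].
  rewrite (_ : \bigcap_(_ in _) _ = setT); last by rewrite -subTset => x _ j.
  by rewrite setIT; exact: closed_union_itv.
have -> : [set` `[0, c]] `&` \bigcap_(j in [set j | j \in i :: s]) Ci j =
    Ci i `&` (`[0, c] `&` \bigcap_(j in [set j | j \in s]) Ci j) :> set R.
  apply/seteqP; split => x.
    move=> [xc h]; split; first by apply: h; rewrite /= mem_head.
    by split => // j js; apply: h; rewrite /= inE orbC js.
  move=> [xi [xc h]]; split => // j /=; rewrite inE => /predU1P[->//|js].
  exact: h.
exact: closed_unionI.
Qed.

(** Any affordable allocation scores at most [S], so passing to it loses at least [Gam];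
    [genH_sub_le] bounds each agent's share of that loss. *)
Lemma removal_loss X X' G G' (S Gam : R) :
  (forall Y H, is_allocation c alpha Y H ->
     \sum_(i < n) genH (u Y H i) <= S) ->
  \sum_(i < n) genH (u X G i) = S + Gam ->
  is_allocation c alpha X' G' ->
  (forall i, 0 <= u X G i - u X' G' i <= 1) ->
  Gam <= \sum_(i < n) (u X G i - u X' G' i) / u X G i.
Proof.
move=> opt SG /opt le_S d01.
have -> : Gam = \sum_(i < n) genH (u X G i) - S by rewrite SG addrAC subrr add0r.
rewrite lerBlDr -lerBlDl; apply: le_trans le_S.
rewrite -sumrB; apply: ler_sum => i _; have /andP[d0 d1] := d01 i.
rewrite lerBlDl -lerBlDr; apply: le_trans (genH_sub_le d0 d1 _).
  by rewrite subKr.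
by rewrite gerBl util_ge0.
Qed.

(** Summing the loss bound over all single goods, and rescaling the one for cake, charges each agent
    her goods and cake utilities divided by their sum, so at most 1. The total charge is thus at
    most [n], while it is at least about [Gam] per unit of size. *)
Lemma removal_bound X G (S Gam : R) : closed_union c X ->
  (forall Y H, is_allocation c alpha Y H ->
     \sum_(i < n) genH (u Y H i) <= S) ->
  \sum_(i < n) genH (u X G i) = S + Gam -> 0 < Gam ->
  alpha < bsize X G -> bsize X G <= alpha + 1 ->
  alpha * Gam < n%:R.
Proof.
move=> cX opt SG Gam0 lt_al le_al1; set e := bsize X G - alpha.
have e0 : 0 < e by rewrite subr_gt0.
have e1 : e <= 1 by rewrite lerBlDl.
have goods : #|G|%:R * Gam <= \sum_(i < n) #|Gi i :&: G|%:R / u X G i.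
  have h g : g \in G -> Gam <= \sum_(i < n) (g \in Gi i)%:R / u X G i.
    move=> gG.
    have du i : u X G i - u X (G :\ g) i = (g \in Gi i)%:R.
      rewrite /util opprD addrACA subrr add0r.
      rewrite (cardsD1 g (Gi i :&: G)) inE gG andbT finset.setIDA natrD.
      by rewrite addrK.
    under eq_bigr do rewrite -du.
    apply: (removal_loss opt SG) => [|i]; last by rewrite du; case: (g \in _); rewrite lexx ler01.
    split; first exact: is_piece_closed_union.
    (* The excess over the budget is at most 1, so dropping one good suffices. *)
    move: le_al1; rewrite /bsize (cardsD1 g G) gG natrD mulr1n; lra.
  rewrite mulr_natl -sumr_const; apply: le_trans (ler_sum _ h) _.
  rewrite exchange_big/=; apply: ler_sum => i _.
  rewrite -mulr_suml ler_wpM2r ?invr_ge0 ?util_ge0//.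
  rewrite -natr_sum ler_nat -sum1_card big_mkcond [leqRHS]big_mkcond /=.
  by apply: leq_sum => g _; rewrite inE; case: (g \in G); case: (g \in Gi i).
have cake : e <= len X -> len X / e * Gam <= \sum_(i < n) len (Ci i `&` X) / u X G i.
  move=> eX; have X0 : 0 < len X by exact: lt_le_trans eX.
  (* The index [None] tracks [X] itself: the cake kept then has length exactly [len X - e], which
     meets the budget. *)
  pose D (o : option 'I_n) := if o is Some i then Ci i `&` X else X.
  have [||||Z cZ lZ] := @step_set_scale R c (1 - e / len X) _ D => //.
  - by rewrite subr_ge0 ler_pdivrMr ?mul1r.
  - by rewrite gerBl divr_ge0 ?ltW.
  - by case=> [i|]; apply: step_set_closed_union => //; exact: closed_unionI.
  have du i : u X G i - u (X `&` Z) G i = e / len X * len (Ci i `&` X).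
    by rewrite /util setIA (lZ (Some i)) /=; ring.
  have lCX i : len (Ci i `&` X) <= len X.
    apply: (@le_len _ 0 c).
    - by apply: measurable_closed_union; exact: closed_unionI.
    - exact: measurable_closed_union cX.
    - exact: subIsetr.
    - exact: closed_union_sub.
  have eX0 : 0 <= e / len X by rewrite divr_ge0 ?ltW.
  have := @removal_loss X (X `&` Z) G G S Gam opt SG _ _.
  have -> : \sum_(i < n) (u X G i - u (X `&` Z) G i) / u X G i =
      e / len X * \sum_(i < n) len (Ci i `&` X) / u X G i.
    by rewrite mulr_sumr; apply: eq_bigr => i _; rewrite du mulrA.
  move=> h; rewrite -ler_pdivlMl ?divr_gt0// invf_div; apply: h.
    split; first by apply: is_piece_closed_union; exact: closed_unionI.
    rewrite /bsize (lZ None)/= mulrBl mul1r divfK ?gt_eqF// /e /bsize; lra.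
  move=> i; rewrite du mulr_ge0 ?len_ge0//=; apply: le_trans e1.
  have X_neq0 : len X != 0 by rewrite gt_eqF.
  by rewrite -[leRHS](divfK X_neq0) ler_wpM2l.
have total : \sum_(i < n) #|Gi i :&: G|%:R / u X G i +
    \sum_(i < n) len (Ci i `&` X) / u X G i <= n%:R.
  rewrite -big_split/= -[X in _ <= X%:R]card_ord -sum1_card natr_sum.
  apply: ler_sum => i _; rewrite -mulrDl addrC.
  (* An agent with utility 0 is charged 0, by the convention that the inverse of 0 is 0. *)
  have [->|u0] := eqVneq (u X G i) 0; first by rewrite invr0 mulr0.
  by rewrite divff.
have cake0 : 0 <= \sum_(i < n) len (Ci i `&` X) / u X G i.
  by apply: sumr_ge0 => i _; rewrite divr_ge0 ?len_ge0 ?util_ge0.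
(* If [e <= len X], then [e <= 1] gives [len X <= len X / e], and both bounds add up. Otherwise the
   goods alone exceed [alpha], and their bound suffices. *)
have [eX|Xe] := leP e (len X).
  have : (bsize X G) * Gam <= n%:R; last first.
    by apply: lt_le_trans; rewrite ltr_pM2r.
  apply: le_trans total; rewrite /bsize addrC mulrDl lerD//.
  apply: le_trans (cake eX); rewrite ler_pM2r// ler_pdivlMr// ler_piMr ?len_ge0//.
apply: lt_le_trans (_ : #|G|%:R * Gam <= _).
  by rewrite ltr_pM2r//; move: Xe; rewrite /e /bsize; lra.
by apply: le_trans goods _; apply: le_trans total; rewrite lerDl.
Qed.

(** Either a commonly approved good is missing from [G] and can be added, or [G] contains them all;
    then the low average forces common cake of length at least 1 outside [X]. *)
Lemma add_common_unit X G Ns (t : R) : closed_union c X -> Ns != finset.set0 ->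
  t <= bsize (`[0, c] `&` \bigcap_(i in [set i | i \in Ns]) Ci i)
             (\bigcap_(i in Ns) Gi i)%SET ->
  avg_sat Ci Gi Ns X G <= t - 1 ->
  exists X' G', [/\ closed_union c X', bsize X' G' = bsize X G + 1,
    forall i, i \in Ns -> u X' G' i = u X G i + 1 &
    forall i, u X G i <= u X' G' i].
Proof.
move=> cX /finset.set0Pn Ns0 tB avg.
set B := [set` `[0, c]] `&` _ in tB; set GB := (\bigcap_(i in Ns) Gi i)%SET in tB.
have cB : closed_union c B by exact: closed_union_bigcap.
have [/fintype.subsetP GBG|/fintype.subsetPn[g gB gG]] := boolP (GB \subset G); last first.
  have du i : u X (g |: G) i = u X G i + (g \in Gi i)%:R.
    rewrite /util -addrA -natrD; congr (_ + _%:R).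
    rewrite (cardsD1 g (Gi i :&: (g |: G))) inE setU11 andbT addnC; congr (_ + _)%N.
    apply: eq_card => h; rewrite !inE; case: eqVneq => //= ->.
    by rewrite (negbTE gG) andbF.
  exists X, (g |: G); split => //.
  - by rewrite /bsize cardsU1 gG natrD mulr1n [1 + _]addrC addrA.
  - by move=> i iN; rewrite du; move/finset.bigcapP : gB => /(_ i iN) ->.
  - by move=> i; rewrite du lerDl.
have [mX sX] := (measurable_closed_union cX, closed_union_sub cX).
have [mB sB] := (measurable_closed_union cB, closed_union_sub cB).
have BCi i : i \in Ns -> B `<=` Ci i by move=> iN x [_]; exact.
have common_le i : i \in Ns -> len (B `&` X) + #|GB|%:R <= u X G i.
  move=> iN; rewrite lerD//.
    apply: (@le_len _ 0 c); first exact: measurableI.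
    - by apply: measurableI => //; exact: measurable_closed_union (pCi i).
    - by apply: setSI; exact: BCi.
    - by move=> x [_ /sX].
  rewrite ler_nat subset_leq_card//; apply/fintype.subsetP => g gB.
  by rewrite inE GBG// andbT; move/finset.bigcapP : gB => /(_ i iN).
have Ns_gt0 : 0 < #|Ns|%:R :> R by rewrite ltr0n card_gt0; apply/finset.set0Pn.
(* Every member already enjoys the common part of the allocation, so its size is at most their
   average. *)
have BX_le : len (B `&` X) + #|GB|%:R <= t - 1.
  apply: le_trans avg; rewrite ler_pdivlMr// mulr_natr -sumr_const.
  exact: ler_sum.
set L := len (B `\` X).
have L1 : 1 <= L.
  have : len B = L + len (B `&` X).
    rewrite -(@lenU _ 0 c).
    - by rewrite setUC setUIDK.
    - exact: measurableD.
    - exact: measurableI.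
    - by move=> x [/sB].
    - by move=> x [/sB].
    - by rewrite -subset0 => x [[_ ?] [_ ?]].
  by move: tB; rewrite /bsize; lra.
have L0 : 0 < L by lra.
pose D (o : option 'I_n) := if o is Some i then (Ci i `&` B) `\` X else B `\` X.
have sD o : step_set c (D o).
  case: o => [i|]; apply: step_setD; apply: step_set_closed_union => //.
  exact: closed_unionI.
(* The factor [1 / L] selects length exactly 1 from the common cake outside [X]. *)
have [||Z cZ lZ] := step_set_scale (theta := L^-1) c0 _ _ sD.
- by rewrite invr_ge0 ltW.
- by rewrite invf_le1.
have lenUD Y E : measurable Y -> Y `<=` `[0, c] -> step_set c E -> Y `&` E = set0 ->
    len (Y `|` (E `&` Z)) = len Y + len (E `&` Z).
  move=> mY sY [mE sE _] YE; apply: (@lenU _ 0 c) => //.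
  - by apply: measurableI => //; exact: measurable_closed_union cZ.
  - by move=> x [/sE].
  - by rewrite setIA YE set0I.
have du i : u (X `|` (B `&` Z)) G i = u X G i + L^-1 * len ((Ci i `&` B) `\` X).
  rewrite /util addrAC; congr (_ + _); rewrite -(lZ (Some i)) -lenUD//.
  - congr len; apply/seteqP; split => x.
      move=> [Cx [Xx|[Bx Zx]]]; first by left.
      by have [Xx|Xx] := pselect (X x); [left|right].
    by move=> [[Cx Xx]|[[[Cx Bx] Xx] Zx]]; split => //; [left|right].
  - by apply: measurableI => //; exact: measurable_closed_union (pCi i).
  - by move=> x [_ /sX].
  - by rewrite -subset0 => x [[_ ?] [_ ?]].
(* Adding all of [B] within [Z], not only what lies outside [X], keeps the result a piece and does
   not change the union. *)
exists (X `|` (B `&` Z)), G; split.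
- by apply: closed_unionU => //; exact: closed_unionI.
- rewrite /bsize addrAC; congr (_ + _).
  have -> : 1 = len (D None `&` Z) by rewrite lZ mulVf// gt_eqF.
  rewrite -lenUD//; last by rewrite -subset0 => x [? [_ ?]].
  congr len; apply/seteqP; split => x.
    move=> [Xx|[Bx Zx]]; first by left.
    by have [Xx|Xx] := pselect (X x); [left|right].
  by move=> [Xx|[[Bx Xx] Zx]]; [left|right].
- by move=> i iN; rewrite du setIidr; [rewrite mulVf// gt_eqF|exact: BCi].
- by move=> i; rewrite du lerDl mulr_ge0 ?len_ge0// invr_ge0 ltW.
Qed.

(* The convex function 1/y lies above its tangent at y = t, which avoids the
   inequality between arithmetic and harmonic means. *)
Lemma gain_bound Ns X G X' G' (t : R) : 0 < t -> (0 < #|Ns|)%N ->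
  t * n%:R / alpha <= #|Ns|%:R ->
  avg_sat Ci Gi Ns X G <= t - 1 ->
  (forall i, i \in Ns -> u X' G' i = u X G i + 1) ->
  (forall i, u X G i <= u X' G' i) ->
  n%:R / alpha <= \sum_(i < n) genH (u X' G' i) - \sum_(i < n) genH (u X G i).
Proof.
move=> t0 Ns0 Nst avg uNs uX; have Ns_gt0 : 0 < #|Ns|%:R :> R by rewrite ltr0n.
have sum_u : \sum_(i in Ns) u X G i <= (t - 1) * #|Ns|%:R.
  by rewrite -ler_pdivrMr.
apply: (@le_trans _ _ (\sum_(i in Ns) (2 / t - (u X G i + 1) / t ^+ 2))).
  rewrite big_split/= sumr_const sumrN -mulr_suml big_split/= sumr_const -[2 / t *+ _]mulr_natr.
  apply: (@le_trans _ _ (#|Ns|%:R / t)).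
    by rewrite ler_pdivlMr//; apply: le_trans Nst; rewrite mulrC mulrA.
  have -> : #|Ns|%:R / t = 2 / t * #|Ns|%:R - t * #|Ns|%:R / t ^+ 2.
    by field; rewrite gt_eqF.
  by rewrite lerD2l lerN2 ler_pM2r ?invr_gt0 ?exprn_gt0//; lra.
rewrite -sumrB [leRHS](bigID (mem Ns))/= -[leLHS]addr0 lerD//; last first.
  by apply: sumr_ge0 => i _; rewrite subr_ge0 genH_le// util_ge0.
apply: ler_sum => i iN; rewrite uNs//; set x := u X G i.
have x0 : 0 <= x by exact: util_ge0.
apply: le_trans (genH_add1 x0); rewrite -subr_ge0.
have -> : (x + 1)^-1 - (2 / t - (x + 1) / t ^+ 2) = (t - (x + 1)) ^+ 2 / ((x + 1) * t ^+ 2).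
  by field; rewrite !gt_eqF//; lra.
by rewrite divr_ge0 ?sqr_ge0// mulr_ge0 ?sqr_ge0//; lra.
Qed.
End Instance.

(** * The lower bound on average satisfaction *)

Theorem mainTheorem19 (R : realType) (n m : nat) (c alpha : R)
    (Ci : 'I_n -> set R) (Gi : 'I_n -> {set 'I_m})
    (t : R) (Ns : {set 'I_n}) (X : set R) (G : {set 'I_m}) :
  (0 < n)%N -> 0 <= c -> 0 < Num.max c m%:R ->
  0 < alpha -> alpha <= c + m%:R ->
  (forall i, is_piece c (Ci i)) ->
  1 <= t ->
  cohesive c alpha Ci Gi t Ns ->
  is_genPAV c alpha Ci Gi X G ->
  t - 1 < avg_sat Ci Gi Ns X G.
Proof.
move=> n0 c0 _ alpha0 _ pCi t1 [Nst tB] [[pX sizeX] opt].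
have {}pCi i : closed_union c (Ci i) by exact: closed_union_is_piece.
have cX : closed_union c X by exact: closed_union_is_piece.
have t0 : 0 < t by lra.
have n_alpha : 0 < n%:R / alpha by rewrite divr_gt0// ltr0n.
have Ns0 : (0 < #|Ns|)%N.
  by rewrite -(ltr0n R); apply: lt_le_trans Nst; rewrite -mulrA mulr_gt0.
rewrite ltNge; apply/negP => avg.
have [|X' [G' [cX' size' uNs uX]]] := add_common_unit c0 pCi cX _ tB avg.
  by rewrite -card_gt0.
have gain := gain_bound t0 Ns0 Nst avg uNs uX.
set S := \sum_(i < n) genH (util (Ci i) (Gi i) X G) in gain opt.
set S' := \sum_(i < n) _ in gain.
(* An affordable enlarged allocation would beat the optimum, as the gain is positive. *)
have lt_al : alpha < bsize X' G'.
  rewrite ltNge; apply/negP => le_al.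
  have /opt : is_allocation c alpha X' G' by split => //; exact: is_piece_closed_union.
  by rewrite -/S'; lra.
have SS : S' = S + (S' - S) by rewrite addrC subrK.
(* With [Gam = S' - S] this yields [alpha * Gam < n], against the gain of at least [n / alpha]. *)
have := removal_bound c0 pCi cX' opt SS (lt_le_trans n_alpha gain) lt_al.
rewrite size' lerD2r sizeX => /(_ isT).
by rewrite ltNge mulrC -ler_pdivrMr// gain.
Qed.
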